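(* Let $G=(V,E,c)$ be an undirected, connected graph with positive edge costs, let $Q$ and $T$ be trajectories in $G$ and $s$ a time interval. If for any $u,v\in V$ the shortest-path distance $d(u,v)$ can be obtained in constant time, then $Sim(Q,T,s)$ can be computed in $\mathcal{O}(|Q|+|T|)$ time, where $|Q|$ and $|T|$ denote the number of pairs in $Q$ and $T$.
   Context: $G=(V,E,c)$ is an undirected graph with finite vertex set $V$, edges $E\subseteq\{\{u,v\}\subseteq V: u\neq v\}$ and cost function $c:E\to\mathbb{R}_{>0}$; $d(u,v)$ is the shortest-path distance. A time interval is $[a,b]$ with $a,b\in\mathbb{Z}$, $a<b$; $|I|$ denotes the length of an interval $I$ ($b-a$ for $[a,b]$, $0$ for empty or degenerate intersections). A trajectory is a sequence $T=((v_1,t_1),\dots,(v_\ell,t_\ell))$ with $v_i\in V$, $t_i=[a_i,b_i]$ time intervals, $a_{i+1}=b_i$ and $v_i\neq v_{i+1}$ for $1\le i<\ell$. For trajectories $T=((v_1,t_1),\dots,(v_\ell,t_\ell))$, $Q=((u_1,s_1),\dots,(u_k,s_k))$ and a time interval $s$, $$Sim(Q,T,s)=\frac{1}{|s|}\sum_{(v_i,t_i)\in T,\ (u_j,s_j)\in Q}|s\cap t_i\cap s_j|\cdot e^{-d(v_i,u_j)}.$$ *)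

(* Defs.v *)
From HB Require Import structures.
From mathcomp Require Import all_boot all_order all_algebra.
From mathcomp Require Import classical_sets reals sequences exp.

Set Implicit Arguments.
Unset Strict Implicit.
Unset Printing Implicit Defensive.
Import Order.TTheory GRing.Theory Num.Theory.
Local Open Scope ring_scope.

(* Values of [cost] outside [edges] are never used. *)
Record wgraph (R : realType) := WGraph {
  vertex :> finType;
  edges : {set {set vertex}};
  cost : {set vertex} -> R;
  edges_card2 : forall e, e \in edges -> #|e| = 2%N;
  cost_gt0 : forall e, e \in edges -> 0 < cost e }.

Section Graph.
Variables (R : realType) (G : wgraph R).

Definition adj : rel G := fun u v => [set u; v]%SET \in edges G.

Definition connected_graph : Prop := forall u v : G, connect adj u v.

Definition walk_cost (u : G) (p : seq G) : R :=
  \sum_(e <- pairmap (fun x y => [set x; y]%SET) u p) cost e.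

(* In a connected graph this infimum is a minimum: deleting cycles does not
   increase the cost, and there are finitely many simple paths. *)
Definition dist (u v : G) : R :=
  inf [set walk_cost u p | p in [set p | path adj u p /\ last u p = v]]%classic.

End Graph.

(* [(a, b)] stands for the closed interval [a, b], empty when [b < a]. *)
Definition itvl : Type := (int * int)%type.

Definition time_interval (I : itvl) : bool := I.1 < I.2.

Definition cap (I J : itvl) : itvl :=
  (Num.max I.1 J.1, Num.min I.2 J.2).

Definition len (I : itvl) : int := if I.1 <= I.2 then I.2 - I.1 else 0.

Lemma mem_cap (R : realType) (I J : itvl) (x : R) :
  ((cap I J).1%:~R <= x <= (cap I J).2%:~R) =
  (I.1%:~R <= x <= I.2%:~R) && (J.1%:~R <= x <= J.2%:~R).
Proof.
have maxE (a b : int) : ((Num.max a b)%:~R <= x) = (a%:~R <= x) && (b%:~R <= x).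
  by case: (leP a b) => [ab|/ltW ab]; apply/idP/andP => [h|[]//]; split=> //;
    apply: le_trans h; rewrite ler_int.
have minE (a b : int) : (x <= (Num.min a b)%:~R) = (x <= a%:~R) && (x <= b%:~R).
  by case: (leP a b) => [ab|/ltW ab]; apply/idP/andP => [h|[]//]; split=> //;
    apply: le_trans h _; rewrite ler_int.
by rewrite maxE minE andbACA.
Qed.

Definition trajectory (V : eqType) (T : seq (V * itvl)) : bool :=
  all (fun p => time_interval p.2) T &&
  sorted (fun p q => (q.2.1 == p.2.2) && (p.1 != q.1)) T.

Definition Sim (R : realType) (G : wgraph R) (Q T : seq (G * itvl)) (s : itvl)
    : R :=
  (len s)%:~R^-1 *
  \sum_(p <- T) \sum_(q <- Q)
     (len (cap s (cap p.2 q.2)))%:~R * expR (- dist p.1 q.1).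

(* A real RAM with a distance oracle [Dist].  Integer and real registers are
   addressed by constants occurring in the program; integer and real memories
   are addressed by the content of an integer register.  Every instruction has
   unit cost.  Operands are listed destination first, jump targets last.
   Programs contain no real constants and no data of the graph. *)
Inductive instr : Type :=
  | IConst of nat & int
  | IAdd of nat & nat & nat
  | ISub of nat & nat & nat
  | ILoad of nat & nat
  | IStore of nat & nat
  | RofInt of nat & nat
  | RAdd of nat & nat & nat
  | RSub of nat & nat & nat
  | RMul of nat & nat & nat
  | RDiv of nat & nat & nat
  | RExp of nat & nat
  | RLoad of nat & nat
  | RStore of nat & nat
  | Dist of nat & nat & nat
  | Jump of nat
  | IJumpLe of nat & nat & nat
  | RJumpLe of nat & nat & nat.

Definition program : Type := seq instr.

Record config (R : realType) := Config {
  pc : nat;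
  ireg : nat -> int;
  rreg : nat -> R;
  imem : int -> int;
  rmem : int -> R }.

Section Machine.
Variables (R : realType) (oracle : int -> int -> R) (P : program).

Definition upd (K : eqType) (A : Type) (f : K -> A) (k : K) (a : A) : K -> A :=
  fun x => if x == k then a else f x.

(* The machine halts when the program counter leaves the program; halted
   configurations are fixed points of [step]. *)
Definition halted (c : config R) : bool := (size P <= pc c)%N.

Definition step (c : config R) : config R :=
  let: Config n i r m w := c in
  match onth P n with
  | None => c
  | Some ins =>
    match ins with
    | IConst x z => Config n.+1 (upd i x z) r m w
    | IAdd x y z => Config n.+1 (upd i x (i y + i z)) r m w
    | ISub x y z => Config n.+1 (upd i x (i y - i z)) r m w
    | ILoad x y => Config n.+1 (upd i x (m (i y))) r m w
    | IStore x y => Config n.+1 i r (upd m (i x) (i y)) w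
    | RofInt x y => Config n.+1 i (upd r x (i y)%:~R) m w
    | RAdd x y z => Config n.+1 i (upd r x (r y + r z)) m w
    | RSub x y z => Config n.+1 i (upd r x (r y - r z)) m w
    | RMul x y z => Config n.+1 i (upd r x (r y * r z)) m w
    | RDiv x y z => Config n.+1 i (upd r x (r y / r z)) m w
    | RExp x y => Config n.+1 i (upd r x (expR (r y))) m w
    | RLoad x y => Config n.+1 i (upd r x (w (i y))) m w
    | RStore x y => Config n.+1 i r m (upd w (i x) (r y))
    | Dist x y z => Config n.+1 i (upd r x (oracle (i y) (i z))) m w
    | Jump l => Config l i r m w
    | IJumpLe x y l => Config (if i x <= i y then l else n.+1) i r m w
    | RJumpLe x y l => Config (if r x <= r y then l else n.+1) i r m w
    end
  end.

Definition init (input : seq int) : config R :=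
  Config 0%N (fun=> 0) (fun=> 0)
    (fun z => if z is Posz n then input`_n else 0) (fun=> 0).

(* As halting is permanent, [k] bounds the number of executed instructions.
   The result is read off real register 0. *)
Definition computes_within (input : seq int) (y : R) (n : nat) : Prop :=
  exists k : nat, [/\ (k <= n)%N,
    halted (iter k step (init input)) &
    rreg (iter k step (init input)) 0%N = y].

End Machine.

(* Vertices are presented to the machine under integer names [name]. *)
Definition encode_trajectory (V : Type) (name : V -> int)
    (T : seq (V * itvl)) : seq int :=
  flatten [seq [:: name p.1; p.2.1; p.2.2] | p <- T].

Definition encode (V : Type) (name : V -> int) (Q T : seq (V * itvl))
    (s : itvl) : seq int :=
  [:: s.1; s.2; (size Q)%:Z; (size T)%:Z] ++
  encode_trajectory name Q ++ encode_trajectory name T.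

(* Main.v *)
Require Import Defs.
From HB Require Import structures.
From mathcomp Require Import all_boot all_order all_algebra.
From mathcomp Require Import boolp classical_sets reals sequences exp.
From mathcomp Require Import zify.

Set Implicit Arguments.
Unset Strict Implicit.
Unset Printing Implicit Defensive.
Import Order.TTheory GRing.Theory Num.Theory.
Local Open Scope ring_scope.

(** Sweep both trajectories simultaneously.  Of the two current pairs, the one
    whose interval ends first meets no later interval of the other trajectory
    in positive length, so once the overlap of the two current pairs is added
    to the sum it can be discarded.  Each round costs a constant number of
    instructions and discards one of the [|Q| + |T|] pairs. *)

(** This is the form in which the program computes a length: raise the right end to the left one,
    then subtract. *)
Lemma len_max (I : itvl) : len I = Num.max I.1 I.2 - I.1.
Proof. by rewrite /len; case: leP => _ //; rewrite subrr. Qed.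

Lemma len_cap_eq0 (s I J : itvl) :
  I.2 <= J.1 \/ J.2 <= I.1 -> len (cap s (cap I J)) = 0.
Proof. by rewrite len_max /cap /= => h; lia. Qed.

Lemma trajectory_cons (V : eqType) (p : V * itvl) (T : seq (V * itvl)) :
  trajectory (p :: T) -> trajectory T.
Proof.
by rewrite /trajectory /= => /andP[/andP[_ ->]] /path_sorted.
Qed.

(** Consecutive intervals share an endpoint and each has positive length, so starting points only
    grow along the list. *)
Lemma trajectory_le (V : eqType) (p q : V * itvl) (T : seq (V * itvl)) :
  trajectory (p :: T) -> q \in T -> p.2.2 <= q.2.1.
Proof.
elim: T p => [//|p' T IH] p trT; rewrite inE => qT.
move: (trT); rewrite /trajectory /= => /andP[/and3P[_ itv' _]].
case/andP=> /andP[/eqP <- _] _.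
case/orP: qT => [/eqP -> //|qT].
exact: le_trans (ltW itv') (IH _ (trajectory_cons trT) qT).
Qed.

Section Overlap.
Variables (R : realType) (G : wgraph R) (s : itvl).
Implicit Types (p q : G * itvl) (Q T : seq (G * itvl)).

Definition overlap p q : R :=
  (len (cap s (cap p.2 q.2)))%:~R * expR (- dist p.1 q.1).

Definition overlaps Q T : R := \sum_(p <- T) \sum_(q <- Q) overlap p q.

Lemma overlap_eq0 p q : p.2.2 <= q.2.1 \/ q.2.2 <= p.2.1 -> overlap p q = 0.
Proof. by move=> /(len_cap_eq0 s) h; rewrite /overlap h mul0r. Qed.

Lemma overlaps_dropQ q Q p T : trajectory (p :: T) -> q.2.2 <= p.2.2 ->
  overlaps (q :: Q) (p :: T) = overlap p q + overlaps Q (p :: T).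
Proof.
move=> trT le_qp; rewrite /overlaps.
under eq_bigr do rewrite big_cons.
rewrite big_split /= big_cons; congr (_ + _).
rewrite -[RHS]addr0; congr (_ + _); apply: big1_seq => p' /andP[_].
move=> /(trajectory_le trT) le_pp'; apply: overlap_eq0; right.
exact: le_trans le_pp'.
Qed.

Lemma overlaps_dropT q Q p T : trajectory (q :: Q) -> p.2.2 <= q.2.2 ->
  overlaps (q :: Q) (p :: T) = overlap p q + overlaps (q :: Q) T.
Proof.
move=> trQ le_pq; rewrite /overlaps !big_cons; congr (_ + _).
rewrite -[RHS]addr0; congr (_ + _); apply: big1_seq => q' /andP[_].
move=> /(trajectory_le trQ) le_qq'; apply: overlap_eq0; left.
exact: le_trans le_qq'.
Qed.

End Overlap.

Local Arguments upd {K A} f k a x /.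
Local Arguments Order.max : simpl never.
Local Arguments Order.min : simpl never.

Lemma upd_id (K : eqType) (A : Type) (f : K -> A) k : upd f k (f k) = f.
Proof. by apply: funext => x; rewrite /upd; case: eqP => [->|]. Qed.

Section Execution.
Variables (R : realType) (oracle : int -> int -> R) (P : program).
Implicit Types (c : config R) (i : nat -> int) (r : nat -> R).
Implicit Types (m : int -> int) (w : int -> R) (y : R).

(** [computes_within] with an arbitrary starting configuration, so that program fragments can be
    chained. *)
Definition halts_within c y (n : nat) : Prop :=
  exists k, [/\ (k <= n)%N,
    halted P (iter k (step oracle P) c) &
    rreg (iter k (step oracle P) c) 0%N = y].

Lemma halts_within0 c y :
  halted P c -> rreg c 0%N = y -> halts_within c y 0.
Proof. by exists 0%N. Qed.

Lemma halts_withinW c y n n' :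
  (n <= n')%N -> halts_within c y n -> halts_within c y n'.
Proof.
by move=> le_n [k [le_k]]; exists k; split=> //; apply: leq_trans le_n.
Qed.

Lemma halts_step c y n :
  halts_within (step oracle P c) y n -> halts_within c y n.+1.
Proof. by case=> k [le_k hk yk]; exists k.+1; rewrite !iterSr. Qed.

(** A conditional jump over a register move: one step if the jump is taken, two otherwise. The zero
    in register 0 turns [IAdd] into the move. *)
Lemma halts_max x z l i r m w y n :
  onth P l = Some (IJumpLe x z l.+2) ->
  onth P l.+1 = Some (IAdd z x 0) -> i 0%N = 0 ->
  halts_within (Config l.+2 (upd i z (Num.max (i x) (i z))) r m w) y n ->
  halts_within (Config l i r m w) y n.+2.
Proof.
move=> e1 e2 i0; case: (leP (i x) (i z)) => [le|lt].
  rewrite upd_id => h; apply/halts_step/(halts_withinW (leqnSn _)).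
  by rewrite /step e1 le.
move=> h; apply/halts_step; rewrite /step e1 leNgt lt /=.
by apply/halts_step; rewrite /step e2 i0 addr0.
Qed.

Lemma halts_min x z l i r m w y n :
  onth P l = Some (IJumpLe z x l.+2) ->
  onth P l.+1 = Some (IAdd z x 0) -> i 0%N = 0 ->
  halts_within (Config l.+2 (upd i z (Num.min (i x) (i z))) r m w) y n ->
  halts_within (Config l i r m w) y n.+2.
Proof.
move=> e1 e2 i0; case: (leP (i z) (i x)) => [le|lt].
  rewrite upd_id => h; apply/halts_step/(halts_withinW (leqnSn _)).
  by rewrite /step e1 le.
move=> h; apply/halts_step; rewrite /step e1 leNgt lt /=.
by apply/halts_step; rewrite /step e2 i0 addr0.
Qed.

End Execution.

(** Integer registers: 0 and 1 hold the constants 0 and 1, 2 and 4 the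
    addresses of the current pairs of [Q] and [T], 3 and 5 the addresses just
    past their ends, 6 and 7 the endpoints of [s], 15 the size of an encoded
    pair.  Real register 0 accumulates the sum; real register 3 stays 0. *)
Definition sim_program : program := [::
  IConst 1 1%:Z; ILoad 6 0; ILoad 7 1; IConst 2 2%:Z; ILoad 3 2;
  IConst 4 3%:Z; ILoad 5 4; IConst 2 4%:Z; IConst 15 3%:Z;
  IAdd 4 3 3; IAdd 4 4 3; IAdd 4 4 2; IAdd 3 4 0;
  IAdd 8 5 5; IAdd 8 8 5; IAdd 5 4 8;
  (* instruction 16, the loop head *)
  IJumpLe 3 2 53; IJumpLe 5 4 53;
  ILoad 8 2; IAdd 2 2 1; ILoad 9 2; IAdd 2 2 1; ILoad 10 2; IAdd 2 2 1;
  ILoad 11 4; IAdd 4 4 1; ILoad 12 4; IAdd 4 4 1; ILoad 13 4; IAdd 4 4 1;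
  (* instruction 30: overlap length, kept in register 14 *)
  IJumpLe 12 9 32; IAdd 9 12 0; IJumpLe 6 9 34; IAdd 9 6 0;
  IAdd 14 10 0; IJumpLe 14 13 37; IAdd 14 13 0; IJumpLe 14 7 39; IAdd 14 7 0;
  IJumpLe 9 14 41; IAdd 14 9 0; ISub 14 14 9;
  RofInt 1 14; Dist 2 11 8; RSub 2 3 2; RExp 2 2; RMul 1 1 2; RAdd 0 0 1;
  (* instruction 48: step back to the pair that ends last *)
  IJumpLe 10 13 51; ISub 2 2 15; Jump 16; ISub 4 4 15; Jump 16;
  (* instruction 53, reached when a trajectory is exhausted *)
  ISub 14 7 6; RofInt 1 14; RDiv 0 0 1].

(** Constrains only one segment of memory, hence passes to the remaining pairs as an address
    advances. *)
Fixpoint stored (m : int -> int) (a : int) (l : seq int) : Prop :=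
  if l is x :: l' then m a = x /\ stored (m : int -> int) (a + 1) l' else True.

Lemma stored_input (l1 l2 l3 : seq int) :
  stored (fun z => if z is Posz n then (l1 ++ l2 ++ l3)`_n else 0)
    (size l1)%:Z l2.
Proof.
(* The prefix is generalised: the head of [l2] moves to the end of [l1]. *)
elim: l2 l1 => [//|x l2 IH] l1 /=; split; first by rewrite nth_cat ltnn subnn.
have := IH (rcons l1 x).
by rewrite size_rcons cat_rcons -addn1 PoszD.
Qed.

Lemma size_encode_trajectory (V : Type) (name : V -> int) (T : seq (V * itvl)) :
  size (encode_trajectory name T) = (3 * size T)%N.
Proof.
by elim: T => //= p T IH; rewrite -/(encode_trajectory name T) IH mulnS.
Qed.

Section Correctness.
Variables (R : realType) (oracle : int -> int -> R).
Variables (G : wgraph R) (name : G -> int) (s : itvl).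
Hypothesis oracleE : forall u v : G, oracle (name u) (name v) = dist u v.
Implicit Types (i : nat -> int) (r : nat -> R) (m : int -> int) (w : int -> R).

Lemma halts_normalise i r m w :
  halts_within oracle sim_program (Config 53 i r m w)
    (r 0%N / (i 7%N - i 6%N)%:~R) 3.
Proof. by do 3!apply: halts_step; apply: halts_within0. Qed.

Lemma halts_loop_end i r m w :
  i 3%N <= i 2%N \/ i 5%N <= i 4%N ->
  halts_within oracle sim_program (Config 16 i r m w)
    (r 0%N / (i 7%N - i 6%N)%:~R) 5.
Proof.
case: (leP (i 3%N) (i 2%N)) => [le32 _|lt23 [//|le54]].
  apply: halts_step; rewrite /= le32.
  exact: halts_withinW (halts_normalise _ _ _ _).
apply: halts_step; rewrite /= leNgt lt23 /=.
apply: halts_step; rewrite /= le54.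
exact: halts_normalise.
Qed.

(** Loop invariant: the accumulator plus the overlaps of the remaining pairs is constant. The final
    5 steps are two exit tests and the division by the length of [s]. *)
Lemma halts_loop (Q T : seq (G * itvl)) i r m w :
  trajectory Q -> trajectory T ->
  i 0%N = 0 -> i 1%N = 1 -> i 15%N = 3 -> i 6%N = s.1 -> i 7%N = s.2 ->
  r 3%N = 0 ->
  i 3%N = i 2%N + (3 * size Q)%:Z -> i 5%N = i 4%N + (3 * size T)%:Z ->
  stored m (i 2%N) (encode_trajectory name Q) ->
  stored m (i 4%N) (encode_trajectory name T) ->
  halts_within oracle sim_program (Config 16 i r m w)
    ((r 0%N + overlaps s Q T) / (s.2 - s.1)%:~R) (35 * (size Q + size T) + 5).
Proof.
have [n] := ubnP (size Q + size T).
(* The memories stay fixed, as the program stores nothing. *)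
elim: n => // n IH in Q T i r *.
move=> lt_n trQ trT i0 i1 i15 i6 i7 r3.
case: Q trQ lt_n => [|q Q] trQ lt_n.
  move=> i3 _ _ _; rewrite /overlaps; under eq_bigr do rewrite big_nil.
  rewrite big1_eq addr0 -i6 -i7; apply: (@halts_withinW _ _ _ _ _ 5).
    by rewrite leq_addl.
  by apply: halts_loop_end; left; rewrite i3 addr0.
case: T trT lt_n => [|p T] trT lt_n.
  move=> _ i5 _ _; rewrite /overlaps big_nil addr0 -i6 -i7.
  apply: (@halts_withinW _ _ _ _ _ 5); first by rewrite leq_addl.
  by apply: halts_loop_end; right; rewrite i5 addr0.
move=> i3 i5 stQ stT.
have [/= mq0 [mq1 [mq2 stQ']]] := stQ.
have [/= mp0 [mp1 [mp2 stT']]] := stT.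
have lt23 : i 2%N < i 3%N by rewrite i3 ltrDl.
have lt45 : i 4%N < i 5%N by rewrite i5 ltrDl.
(* One round takes at most 35 steps: 14 to test and load, 11 to clip the endpoints, 7 to add the
   term, 3 to discard a pair. *)
apply: (@halts_withinW _ _ _ _ _ (35 + (35 * (size Q + size T).+1 + 5))).
  by move=> /=; lia.
apply: halts_step; rewrite /= leNgt lt23 /=.
apply: halts_step; rewrite /= leNgt lt45 /=.
do 12!(apply: halts_step; rewrite /=).
apply: (@halts_max _ _ _ 12 9) => //=.
apply: (@halts_max _ _ _ 6 9) => //=.
apply: halts_step => /=.
apply: (@halts_min _ _ _ 13 14) => //=.
apply: (@halts_min _ _ _ 7 14) => //=.
apply: (@halts_max _ _ _ 9 14) => //=.
do 7!(apply: halts_step; rewrite /=).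
rewrite i0 addr0 i1 mq0 mq1 mq2 mp0 mp1 mp2 i6 i7 r3 sub0r oracleE.
(* The clipping order follows the nesting [cap s (cap p.2 q.2)], so the two sides agree without
   rearrangement. *)
have -> : (Num.max (Num.max s.1 (Num.max p.2.1 q.2.1))
             (Num.min s.2 (Num.min p.2.2 q.2.2)) -
           Num.max s.1 (Num.max p.2.1 q.2.1))%:~R * expR (- dist p.1 q.1) =
          overlap s p q by rewrite /overlap len_max.
apply: halts_step => /=.
(* A tie discards [q], like the non-strict test in the program. Loading moved both addresses on by
   3; the subtraction restores that of the kept pair. *)
case: (leP q.2.2 p.2.2) => [le_qp|/ltW le_pq].
  rewrite (overlaps_dropQ _ _ trT le_qp) addrA.
  do 2!apply: halts_step => /=; rewrite i15 (_ : _ - 3 = i 4%N); last by lia.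
  rewrite -addnS; apply: IH => //=; first exact: trajectory_cons trQ.
  by rewrite i3 /=; lia.
rewrite (overlaps_dropT _ _ trQ le_pq) addrA.
do 2!apply: halts_step => /=; rewrite i15 (_ : _ - 3 = i 2%N); last by lia.
rewrite -addSn; apply: IH => //=; first by move: lt_n => /=; lia.
  exact: trajectory_cons trT.
by rewrite i5 /=; lia.
Qed.

End Correctness.

Theorem theorem1 (R : realType) :
  exists (P : program) (C : nat),
  forall (G : wgraph R) (name : G -> int) (oracle : int -> int -> R)
         (Q T : seq (G * itvl)) (s : itvl),
    connected_graph G ->
    injective name ->
    (forall u v : G, oracle (name u) (name v) = dist u v) ->
    trajectory Q -> trajectory T -> time_interval s ->
    computes_within oracle P (encode name Q T s) (Sim Q T s)
      (C * (size Q + size T).+1)%N.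
Proof.
exists sim_program, 35%N => G name oracle Q T s _ _ oracleE trQ trT s_itv.
change (halts_within oracle sim_program (init R (encode name Q T s))
  (Sim Q T s) (35 * (size Q + size T).+1)).
have -> : Sim Q T s = (0 + overlaps s Q T) / (s.2 - s.1)%:~R.
  by rewrite add0r mulrC /Sim /len (ltW s_itv).
(* The 16 set-up and 5 closing steps fit into the extra 35 granted by the successor. *)
apply: (@halts_withinW _ _ _ _ _ (16 + (35 * (size Q + size T) + 5))).
  by lia.
rewrite /init; set m := (fun z : int => _).
have stQ : stored m 4 (encode_trajectory name Q).
  exact: (stored_input [:: s.1; s.2; (size Q)%:Z; (size T)%:Z]).
have stT : stored m (4 + 3 * size Q)%N (encode_trajectory name T).
  have := stored_input ([:: s.1; s.2; (size Q)%:Z; (size T)%:Z] ++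
    encode_trajectory name Q) (encode_trajectory name T) [::].
  by rewrite cats0 size_cat size_encode_trajectory -catA.
have m_head :
  (m 0 = s.1) * (m 1 = s.2) * (m 2 = (size Q)%:Z) * (m 3 = (size T)%:Z) by [].
clearbody m.
do 16!apply: halts_step => /=.
rewrite !m_head.
apply: (@halts_loop R oracle G name s) => //=; try by lia.
(* The set-up code obtains [3 * size Q] by repeated addition. *)
by rewrite (_ : _ + 4%:Z = (4 + 3 * size Q)%N) //; lia.
Qed.
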